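(* Let $(\Omega,\mathcal A,\mu)$ be a $\sigma$-finite measure space and $K\in(0,\mu(\Omega))$. Let $X$ be a reflexive Banach space that is compactly embedded in $L^1(\Omega)$, let $f:X\to\overline{\mathbb R}$ be proper, lower semicontinuous, convex, bounded from below and coercive, and suppose there is $u_0\in X$ with $f(u_0)<\infty$ and $\|u_0\|_0\le K$. Then for every $\rho>0$ the penalized problem $$\min_{u\in X}f(u)+\rho\,(\|u\|_1-|u|_K)$$ has a global solution.
   Context: $\|u\|_0:=\mu(\{x\in\Omega\mid u(x)\ne0\})$. The largest-$K$-norm is $|u|_K:=\sup_{A\in\mathcal A:\ \mu(A)\le K}\int_A|u|\,d\mu$; $\|u\|_1$ is the $L^1(\Omega)$-norm. $f$ is proper if $f>-\infty$ everywhere and $f(u)<\infty$ for some $u$; $f$ is coercive if $\|u_n\|_X\to\infty$ implies $f(u_n)\to\infty$ for every sequence $(u_n)\subseteq X$. *)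

(* Defs.v *)
From HB Require Import structures.
From mathcomp Require Import all_boot all_order all_algebra.
From mathcomp Require Import all_classical all_reals all_analysis.

Set Implicit Arguments.
Unset Strict Implicit.
Unset Printing Implicit Defensive.

Import Order.TTheory GRing.Theory Num.Theory.
Import numFieldNormedType.Exports.

Local Open Scope classical_set_scope.
Local Open Scope ring_scope.

Section reflexive_space.
Context {R : realType} (X : normedModType R).

Definition topological_dual : set (X -> R^o) :=
  [set g | linear g /\ continuous g].

Definition dual_norm (g : X -> R^o) : R :=
  sup [set `|g x| | x in [set x : X | `|x| <= 1]].

(* A functional on the dual is a function on all of X -> R^o of which only the
   restriction to topological_dual matters. *)
Definition bidual : set ((X -> R^o) -> R) :=
  [set Phi |
    (forall (a : R) (g h : X -> R^o), topological_dual g -> topological_dual h ->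
      Phi (a *: g + h) = a * Phi g + Phi h) /\
    (exists C : R, forall g, topological_dual g ->
      `|Phi g| <= C * dual_norm g)].

(* surjectivity of the canonical map from X to its bidual *)
Definition reflexive_space : Prop :=
  forall Phi, bidual Phi ->
    exists x : X, forall g, topological_dual g -> Phi g = g x.

End reflexive_space.

Section L1_embedding.
Context d (T : measurableType d) (R : realType).
Variable mu : {measure set T -> \bar R}.
Local Open Scope ereal_scope.

Definition L0norm (u : T -> R) : \bar R := mu [set x | u x != 0%R].

Definition L1norm (u : T -> R) : \bar R := 'N[mu]_1[EFin \o u].

Definition largest_norm (K : R) (u : T -> R) : \bar R :=
  ereal_sup [set \int[mu]_(x in A) `|u x|%:E |
    A in [set A | measurable A /\ mu A <= K%:E]].

(* The library puts no vector space structure or topology on LspaceType, so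
   linearity is stated almost everywhere and convergence through the norm. *)
Definition compact_embedding (X : normedModType R)
    (iota : X -> LspaceType1 mu) : Prop :=
  [/\ forall (a : R) (u v : X),
        (iota (a *: u + v)%R : T -> R) =
          (fun x => a * iota u x + iota v x)%R %[ae mu],
      injective iota,
      exists C : R, forall u : X, L1norm (iota u) <= (C * `|u|)%:E
    & forall u_ : nat -> X, bounded_fun u_ ->
        exists (phi : nat -> nat) (g : LspaceType1 mu),
          {homo phi : m n / (m < n)%N} /\
          L1norm (fun x => iota (u_ (phi n)) x - g x)%R @[n --> \oo] --> 0].

End L1_embedding.

Section extended_real_functionals.
Context {R : realType} (X : normedModType R).
Implicit Type f : X -> \bar R.
Local Open Scope ereal_scope.

Definition proper_functional f : Prop :=
  (forall u, -oo < f u) /\ (exists u, f u < +oo).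

(* To be used for f > -oo, so that the right-hand side is never +oo - oo;
   the endpoints t = 0, 1 are harmless since 0 * +oo = 0. *)
Definition convex_functional f : Prop :=
  forall (u v : X) (t : R), (0 <= t <= 1)%R ->
    f (t *: u + (1 - t) *: v)%R <= t%:E * f u + (1 - t)%:E * f v.

Definition bounded_below f : Prop := exists m : R, forall u, m%:E <= f u.

Definition coercive f : Prop :=
  forall u_ : nat -> X, (`|u_ n|%R @[n --> \oo] --> +oo%R) ->
    f (u_ n) @[n --> \oo] --> +oo.

Definition global_solution f (u : X) : Prop := forall v, f u <= f v.

End extended_real_functionals.

(* Main.v *)
(* A minimizing sequence is bounded by coercivity, so along a subsequence its
   image in L^1 converges to some g, and the penalty, which is 2-Lipschitz for
   the L^1 norm, converges to its value at g. Instead of extracting a weakly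
   convergent subsequence in X, consider the sets
   {u | f u <= beta + C e, ||iota u - g||_1 <= e} for e > 0, where beta is the
   limit of f along the sequence: they are closed, convex, bounded, nonempty
   and decrease with e, hence have a common point by reflexivity (Smulian), and
   such a point is a minimizer.
   Smulian's theorem needs Hahn-Banach separation, which is obtained from the
   fact that a minimal sublinear functional is linear. *)
From HB Require Import structures.
Require Import Defs.
From mathcomp Require Import all_boot all_order all_algebra.
From mathcomp Require Import all_classical all_reals all_analysis.
From mathcomp Require Import measurable_realfun ring lra.

Set Implicit Arguments.
Unset Strict Implicit.
Unset Printing Implicit Defensive.

Import Order.TTheory GRing.Theory Num.Theory.
Import numFieldNormedType.Exports.

Local Open Scope classical_set_scope.
Local Open Scope ring_scope.

(** * Sublinear functionals and a Hahn-Banach theorem *)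

Section sublinear.
Context {R : realType} {V : lmodType R}.
Implicit Types (p q : V -> R) (C : set V).

(** For [0 < t] the second inequality is an equality, since it also applies to [t^-1]. *)
Definition sublinear p :=
  (forall u v, p (u + v) <= p u + p v) /\
  (forall t v, 0 <= t -> p (t *: v) <= t * p v).

Definition convex_subset C :=
  forall u v (t : R), C u -> C v -> 0 <= t <= 1 -> C (t *: u + (1 - t) *: v).

Lemma sublinear_le0 p : sublinear p -> p 0 <= 0.
Proof. by case=> _ /(_ 0 0 (lexx 0)); rewrite scale0r mul0r. Qed.

Lemma sublinear_opp_ge0 p v : sublinear p -> 0 <= p v + p (- v).
Proof.
move=> [pD pZ]; apply: le_trans (pD _ _); rewrite subrr.
by have := pD 0 0; rewrite addr0 lerDl.
Qed.

(** Both inequalities pass to the infimum because a sum or a multiple of candidate values dominates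
    a candidate at the corresponding point. The bound [l] makes [inf] a true infimum and not its
    default value. *)
Lemma sublinear_inf (E : V -> set R) (l : V -> R) :
  (forall v, E v !=set0) -> (forall v a, E v a -> l v <= a) ->
  (forall u v a b, E u a -> E v b -> exists2 c, E (u + v) c & c <= a + b) ->
  (forall t v a, 0 <= t -> E v a -> exists2 c, E (t *: v) c & c <= t * a) ->
  sublinear (fun v => inf (E v)).
Proof.
move=> E0 El ED EZ.
have lE v : has_lbound (E v) by exists (l v) => a; exact: El.
have infE v a : E v a -> inf (E v) <= a by move=> Ea; exact: ge_inf.
split=> [u v|t v].
  rewrite -lerBlDr; apply: lb_le_inf => // a Ea.
  rewrite lerBlDr -lerBlDl; apply: lb_le_inf => // b Eb.
  rewrite lerBlDl; have [c Ec cab] := ED _ _ _ _ Ea Eb.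
  exact: le_trans (infE _ _ Ec) cab.
rewrite le_eqVlt => /predU1P[<-|t0].
  have [a Ea] := E0 v; have [c Ec] := EZ 0 v a (lexx 0) Ea.
  by rewrite !mul0r; apply: le_trans; exact: infE.
rewrite -ler_pdivrMl//; apply: lb_le_inf => // a Ea.
rewrite ler_pdivrMl//; have [c Ec ca] := EZ _ _ _ (ltW t0) Ea.
exact: le_trans (infE _ _ Ec) ca.
Qed.

(* The witness is [q v = inf (p (v + t c) - t delta)] over [t >= 0] and
   [c] in [C]. *)
Lemma sublinear_minorant p C (delta : R) : sublinear p -> convex_subset C ->
    C !=set0 -> (forall c, C c -> delta <= p c) ->
  exists q, [/\ sublinear q, forall v, q v <= p v &
    forall c, C c -> q (- c) <= - delta].
Proof.
move=> subp convC [c0 Cc0] Cp; have [pD pZ] := subp.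
pose E v := [set a | exists t c, [/\ 0 <= t, C c &
  a = p (v + t *: c) - t * delta]].
have El v a : E v a -> - p (- v) <= a.
  move=> [t [c [t0 Cc ->]]].
  (* Subadditivity bounds [p (t *: c)] by [p (v + t *: c) + p (- v)], and
     [t * delta <= t * p c <= p (t *: c)], the last inequality being homogeneity for [t^-1]. *)
  have := pD (v + t *: c) (- v); rewrite addrAC subrr add0r => h1.
  have := ler_wpM2l t0 (Cp _ Cc).
  have [->|t'] := eqVneq t 0.
    by rewrite !mul0r scale0r addr0 => _; have := sublinear_opp_ge0 v subp; lra.
  have t1 : 0 < t by rewrite lt_neqAle eq_sym t'.
  have := pZ t^-1 (t *: c); rewrite invr_ge0 scalerA mulVf// scale1r.
  by move=> /(_ t0); rewrite ler_pdivlMl// => h2 h3; lra.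
exists (fun v => inf (E v)).
have lE v : has_lbound (E v) by exists (- p (- v)) => a; exact: El.
split.
- apply: (@sublinear_inf E (fun v => - p (- v))) => //.
  + by move=> v; exists (p (v + 0 *: c0) - 0 * delta), 0, c0.
  + move=> u v _ _ [t [c [t0 Cc ->]]] [s [c' [s0 Cc' ->]]].
    have [ts0|ts] := eqVneq (t + s) 0.
      have [-> ->] : t = 0 /\ s = 0 by split; lra.
      exists (p (u + v + 0 *: c) - 0 * delta); first by exists 0, c.
      by have := pD u v; rewrite !scale0r !addr0 !mul0r; lra.
    have ts1 : 0 < t + s by rewrite lt_neqAle eq_sym ts addr_ge0.
    (* The convex combination for which [(t + s) *: c'' = t *: c + s *: c']. *)
    pose c'' := (t / (t + s)) *: c + (1 - t / (t + s)) *: c'.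
    have Cc'' : C c''.
      apply: convC => //; rewrite divr_ge0 ?(ltW ts1)//=.
      by rewrite ler_pdivrMr// mul1r lerDl.
    exists (p (u + v + (t + s) *: c'') - (t + s) * delta).
      by exists (t + s), c''; rewrite ltW.
    have -> : u + v + (t + s) *: c'' = (u + t *: c) + (v + s *: c').
      rewrite /c'' scalerDr !scalerA mulrBr mulr1 mulrCA divff// mulr1.
      have -> : t + s - t = s by ring.
      by rewrite addrACA.
    by have := pD (u + t *: c) (v + s *: c'); lra.
  + move=> s v _ s0 [t [c [t0 Cc ->]]].
    exists (p (s *: v + (s * t) *: c) - (s * t) * delta).
      by exists (s * t), c; rewrite mulr_ge0.
    by rewrite -scalerA -scalerDr; have := pZ s (v + t *: c) s0; lra.
- move=> v; apply: ge_inf => //; exists 0, c0.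
  by rewrite scale0r mul0r addr0 subr0.
- move=> c Cc; apply: le_trans (_ : p (- c + 1 *: c) - 1 * delta <= _).
    by apply: ge_inf => //; exists 1, c.
  by rewrite scale1r addNr; have := sublinear_le0 subp; lra.
Qed.

(** By minimality, the minorant that [sublinear_minorant] gives for the singleton of [v] and
    [delta = p v] is [p] itself, so [p (- v) <= - p v]. Hence [p] is odd, which turns the sublinear
    inequalities into equalities. *)
Lemma minimal_sublinear_linear p : sublinear p ->
    (forall q, sublinear q -> (forall v, q v <= p v) -> q =1 p) ->
  linear (p : V -> R^o).
Proof.
move=> subp minp; have [pD pZ] := subp.
have pN v : p (- v) = - p v.
  have [|||q [subq qp qN]] := @sublinear_minorant p [set v] (p v) subp.
  - by move=> _ _ t -> -> _; rewrite /= -scalerDl addrCA subrr addr0 scale1r.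
  - by exists v.
  - by move=> _ ->.
  have := qN v erefl; rewrite (minp _ subq qp).
  by have := sublinear_opp_ge0 v subp; lra.
have pD' u v : p (u + v) = p u + p v.
  by have := pD u v; have := pD (u + v) (- v); rewrite addrK pN; lra.
have pZ' t v : 0 <= t -> p (t *: v) = t * p v.
  move=> t0; have := pZ t v t0; have := pZ t (- v) t0.
  by rewrite scalerN !pN; lra.
move=> a u v; rewrite pD'; congr (_ + _).
have [a0|a0] := leP 0 a; first exact: pZ'.
apply: oppr_inj; rewrite -pN -scaleNr pZ'; last by rewrite oppr_ge0 ltW.
by rewrite mulNr.
Qed.

Lemma sublinear_linear_minorant p : sublinear p ->
  exists g : V -> R^o, linear g /\ forall v, g v <= p v.
Proof.
move=> subp.
pose T := {q | sublinear q /\ forall v, q v <= p v}.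
(* The order is reversed, so that the maximal element given by Zorn's lemma is a minimal
   functional. *)
pose r (q1 q2 : T) := `[< forall v, sval q2 v <= sval q1 v >].
have [||||[q [subq qp]] minq] := @Zorn T r.
- by move=> q; exact/asboolP.
- move=> q1 q2 q3 /asboolP q12 /asboolP q23; apply/asboolP => v.
  exact: le_trans (q23 v) (q12 v).
- move=> [q1 h1] [q2 h2] /asboolP q12 /asboolP q21; apply: eq_exist.
  by apply/funext => v; apply: le_anti; rewrite q12 q21.
(* A chain is bounded by its pointwise infimum, or by [p] if it is empty. *)
- move=> A totA; have [[q0 Aq0]|A0] := pselect (A !=set0); last first.
    exists (exist _ p (conj subp (fun v => lexx (p v)))) => q Aq.
    by exfalso; apply: A0; exists q.
  pose E v := [set a | exists2 q : T, A q & a = sval q v].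
  have El v a : E v a -> - p (- v) <= a.
    move=> [[q [subq qp]] Aq ->] /=.
    by have := sublinear_opp_ge0 v subq; have := qp (- v); lra.
  have infE (q : T) v : A q -> inf (E v) <= sval q v.
    by move=> Aq; apply: ge_inf; [exists (- p (- v)) => a; exact: El|exists q].
  have subE : sublinear (fun v => inf (E v)).
    apply: (@sublinear_inf E (fun v => - p (- v))) => //.
    + by move=> v; exists (sval q0 v), q0.
    + move=> u v _ _ [q1 Aq1 ->] [q2 Aq2 ->].
      have [/asboolP q12|/asboolP q21] := totA _ _ Aq1 Aq2.
        exists (sval q2 (u + v)); first by exists q2.
        have [[q2D _] _] := svalP q2.
        by apply: le_trans (q2D _ _) _; rewrite lerD.
      exists (sval q1 (u + v)); first by exists q1.
      have [[q1D _] _] := svalP q1.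
      by apply: le_trans (q1D _ _) _; rewrite lerD.
    + move=> t v _ t0 [q Aq ->]; exists (sval q (t *: v)); first by exists q.
      by have [[_ qZ] _] := svalP q; exact: qZ.
  have Ep v : inf (E v) <= p v.
    by apply: le_trans (infE _ v Aq0) _; have [_] := svalP q0; exact.
  exists (exist _ (fun v => inf (E v)) (conj subE Ep) : T) => q Aq.
  apply/asboolP => v /=; exact: infE.
exists q; split=> //; apply: minimal_sublinear_linear => // q' subq' q'q.
have q'p v : q' v <= p v by exact: le_trans (q'q v) (qp v).
have /(congr1 sval)/= -> // :
  exist _ q' (conj subq' q'p) = exist _ q (conj subq qp) :> T.
by apply: minq; apply/asboolP.
Qed.

End sublinear.

(** * Separation and weak compactness in reflexive spaces *)

Section reflexive_compactness.
Context {R : realType} {X : normedModType R}.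
Implicit Types (C : set X) (g : X -> R^o).

(** Some [delta > 0] bounds the distance from [x] to the points of [C] from below. The minorant of
    the norm for the translate of [C] by [- x] dominates a linear [g], so [g (x - c) <= - delta];
    domination by the norm makes [g] continuous. *)
Lemma closed_convex_separation C x : closed C -> convex_subset C ->
    C !=set0 -> ~ C x ->
  exists g (delta : R), [/\ topological_dual g, 0 < delta &
    forall c, C c -> g x + delta <= g c].
Proof.
move=> clC convC [c0 Cc0] nCx.
have [delta delta0 Cdelta] : exists2 delta : R, 0 < delta &
    forall c, C c -> delta <= `|c - x|.
  have /nbhs_normP[delta /= delta0 dC] : nbhs x (~` C).
    by apply: open_nbhs_nbhs; split=> //; exact: closed_openC.
  exists delta => // c Cc; rewrite leNgt; apply/negP => cx.
  by apply: (dC c) => //=; rewrite distrC.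
pose D := [set v | C (v + x)].
have [||||q [subq qnorm qD]] :=
    @sublinear_minorant R X (fun v => `|v|) D delta.
- split=> [u v|t v t0]; first exact: ler_normD.
  by rewrite normrZ ger0_norm.
- move=> u v t Du Dv t01; rewrite /D/=.
  rewrite (_ : _ + x = t *: (u + x) + (1 - t) *: (v + x)); first exact: convC.
  rewrite !scalerDr addrACA -scalerDl; congr (_ + _).
  by rewrite addrCA subrr addr0 scale1r.
- by exists (c0 - x); rewrite /D/= subrK.
- by move=> c Dc; have := Cdelta _ Dc; rewrite addrK.
have [g [glin gq]] := sublinear_linear_minorant subq.
pose gl : {linear X -> R^o} :=
  HB.pack g (@GRing.isLinear.Build R X R^o _ g glin).
exists g, delta; split => //.
- split => //.
  have gn v : `|g v| <= `|v|.
    rewrite ler_norml; apply/andP; split; last exact: le_trans (gq v) (qnorm v).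
    have gN : g (- v) = - g v by exact: (raddfN gl).
    by rewrite lerNl -gN -[leRHS]normrN; exact: le_trans (gq _) (qnorm _).
  apply: (@bounded_linear_continuous R X R^o gl); apply/linear_boundedP.
  exists 1; split; first exact: num_real.
  by move=> r /ltW r1 v; apply: le_trans (gn v) _; exact: ler_peMl.
- move=> c Cc; have Dcx : D (c - x) by rewrite /D/= subrK.
  have := le_trans (gq _) (qD _ Dcx).
  have -> : g (- (c - x)) = g x - g c by rewrite opprB; exact: (raddfB gl).
  by rewrite lerBlDl lerBrDr.
Qed.

Lemma dual_norm_ge0 g : 0 <= dual_norm g.
Proof.
rewrite /dual_norm; set S := [set _ | _ in _].
(* Without a supremum, [sup] is 0 by default. *)
have [supS|/sup_out->//] := pselect (has_sup S).
apply: le_trans (normr_ge0 (g 0)) _; apply: sup_upper_bound => //.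
by exists 0 => //=; rewrite normr0.
Qed.

Lemma ler_dual_norm g v : topological_dual g -> `|g v| <= dual_norm g * `|v|.
Proof.
move=> [glin gcts].
pose gl : {linear X -> R^o} :=
  HB.pack g (@GRing.isLinear.Build R X R^o _ g glin).
(* This bound only serves to show that the set whose supremum is [dual_norm g] is bounded. *)
have [M gM] : exists M, forall v, `|g v| <= M * `|v|.
  have /linear_boundedP : bounded_near gl (nbhs 0).
    by apply: continuous_linear_bounded; exact: gcts.
  by move=> /pinfty_ex_gt0[M _ gM]; exists M.
have [->|v0] := eqVneq v 0.
  by have -> : g 0 = 0 by [exact: (raddf0 gl)]; rewrite !normr0 mulr0.
rewrite -ler_pdivrMr ?normr_gt0//; apply: sup_ubound.
  exists `|M| => _ [w /= w1 <-]; apply: le_trans (gM w) _.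
  apply: le_trans (ler_norm _) _; rewrite normrM normr_id.
  by rewrite ler_piMr.
exists (`|v|^-1 *: v) => /=.
  by rewrite normrZ ger0_norm ?invr_ge0// mulVf ?normr_eq0.
have -> : g (`|v|^-1 *: v) = `|v|^-1 *: g v by exact: (linearZZ gl).
by rewrite normrZ ger0_norm ?invr_ge0// mulrC.
Qed.

(** Lets the compactness of a segment apply to the values of a functional along an ultrafilter. *)
Lemma ultra_fmap (S U : Type) (h : S -> U) (F : set_system S) :
  UltraFilter F -> UltraFilter (h @ F).
Proof.
move=> FU; split=> [|G GF FG]; first exact: fmap_proper_filter.
apply/seteqP; split=> [A GA|//].
have [//|FA] := in_ultra_setVsetC (h @^-1` A) FU.
have GnA : G (~` A) by apply: FG.
by have [y []] := filter_ex (filterI GA GnA).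
Qed.

(* An ultrafilter refining [F] turns evaluation at points into a bounded
   functional on the dual, which reflexivity represents by a point; Hahn-Banach
   separation puts this point in each of the sets. *)
Lemma reflexive_space_compact (F : set_system X) (M : R) :
  reflexive_space X -> ProperFilter F -> F [set v | `|v| <= M] ->
  exists x, forall C, closed C -> convex_subset C -> F C -> C x.
Proof.
move=> reflX FF FM; have [G [GU FG]] := ultraFilterLemma FF.
have GM := FG _ FM.
have bndg g : topological_dual g ->
    G [set v | - (M * dual_norm g) <= (g v : R) <= M * dual_norm g].
  move=> dg; apply: filterS GM => v /= vM; rewrite -ler_norml.
  apply: le_trans (ler_dual_norm v dg) _; rewrite mulrC ler_wpM2r//.
  exact: dual_norm_ge0.
have cvgg g : topological_dual g -> cvg (g @ G).
  move=> dg; have UG := ultra_fmap g GU.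
  have := @segment_compact R (- (M * dual_norm g)) (M * dual_norm g).
  rewrite compact_ultra => /(_ _ UG)[|p [_ gp]].
    by apply: (@filterS _ G _ _ _ _ (bndg g dg)) => v /=; rewrite in_itv.
  exact: cvgP gp.
pose Phi g : R := lim (g @ G).
have [|x Phix] := reflX Phi.
  split=> [a g h dg dh|].
    apply: (@cvg_lim R^o) => //.
    by apply: cvgD; [apply: cvgZr; exact: cvgg|exact: cvgg].
  exists M => g dg; rewrite ler_norml; apply/andP; split.
    apply: limr_ge; first exact: cvgg.
    by apply: filterS (bndg g dg) => v /= /andP[].
  apply: limr_le; first exact: cvgg.
  by apply: filterS (bndg g dg) => v /= /andP[].
exists x => C clC convC FC; apply: contrapT => nCx.
have [g [delta [dg delta0 gC]]] :=
  closed_convex_separation clC convC (filter_ex FC) nCx.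
(* The separating inequality holds on [C], which belongs to [G], so it passes to the limit and
   contradicts [Phi g = g x]. *)
suff : g x + delta <= Phi g by rewrite Phix// gerDl leNgt delta0.
apply: limr_ge; first exact: cvgg.
by apply: filterS (FG _ FC).
Qed.

End reflexive_compactness.

(** * Minimization of a convex coercive functional plus a penalty *)

Section existence_of_minimizers.
Context {R : realType} {X : normedModType R}.
Variable f : X -> \bar R.
Hypotheses (f_convex : convex_functional f) (f_coercive : coercive f).

(** Otherwise the sublevel set contains points [u_ n] of norm above [n], and coercivity makes
    [f (u_ n)] eventually at least [r + 1]. *)
Lemma coercive_sublevel_bounded (r : R) :
  exists M : R, forall u, (f u <= r%:E)%E -> `|u| <= M.
Proof.
apply: contrapT => nM.
have /choice[u_ uP] (n : nat) : exists u, (f u <= r%:E)%E /\ n%:R < `|u|.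
  apply: contrapT => nu; apply: nM; exists n%:R => u fu.
  by rewrite leNgt; apply/negP => un; apply: nu; exists u.
have /f_coercive : `|u_ n| @[n --> \oo] --> +oo.
  apply/cvgryPge => A; near=> n.
  by apply: le_trans (ltW (uP n).2); near: n; exact: nbhs_infty_ger.
move=> /cvgeyPge/(_ (r + 1))/filter_ex[n]; apply/negP; rewrite -ltNge.
by apply: le_lt_trans (uP n).1 _; rewrite lte_fin ltrDl.
Unshelve. all: by end_near. Qed.

Lemma convex_sublevel (r : R) : convex_subset [set u | (f u <= r%:E)%E].
Proof.
move=> u v t /= fu fv t01; have /andP[t0 t1] := t01.
apply: le_trans (f_convex _ _ t01) _.
have -> : r%:E = (t%:E * r%:E + (1 - t)%:E * r%:E)%E.
  by rewrite -!EFinM -EFinD; congr EFin; ring.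
by apply: leeD; apply: lee_wpmul2l => //; rewrite lee_fin ?subr_ge0.
Qed.

(* [h u] stands for the distance from [iota u] to the limit of a subsequence,
   which is not known to be in the image of [X], and [p] for the value of [P]
   at that limit. *)
Lemma exists_global_solution (P : X -> R) (c : R) :
  reflexive_space X -> proper_functional f -> lower_semicontinuous f ->
  bounded_below f -> 0 <= c -> (forall u, 0 <= P u) ->
  (forall u_ : nat -> X, bounded_fun u_ ->
    exists (phi : nat -> nat) (h : X -> R) (p : R),
    [/\ {homo phi : m n / (m < n)%N}, continuous h,
      forall u v (t : R), 0 <= t <= 1 ->
        h (t *: u + (1 - t) *: v) <= t * h u + (1 - t) * h v,
      h (u_ (phi n)) @[n --> \oo] --> 0 &
      forall u, `|P u - p| <= c * h u]) ->
  exists ubar, global_solution (fun u => f u + (P u)%:E)%E ubar.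
Proof.
move=> reflX [fNy [u0 fu0]] f_lsc [m mf] c0 P0 compactP.
(* Only finite values enter [A], so the infimum is taken in [R]; properness makes [A] nonempty. *)
pose A := [set r | exists u, (f u + (P u)%:E)%E = r%:E].
have A0 : A !=set0.
  case E: (f u0) => [r| |].
  - by exists (r + P u0), u0; rewrite E.
  - by rewrite E in fu0.
  - by have := fNy u0; rewrite E.
have lbA : lbound A m.
  move=> r [u /= ur]; rewrite -lee_fin -ur.
  by rewrite -[m%:E]adde0 leeD// lee_fin.
have lA : has_lbound A by exists m.
pose alpha := inf A.
have alphaP v : (alpha%:E <= f v + (P v)%:E)%E.
  case E: (f v) => [r| |]; last by have := fNy v; rewrite E.
    by rewrite -EFinD lee_fin; apply: ge_inf => //; exists v; rewrite E.
  by rewrite addye// leey.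
have /choice[u_ uP] (n : nat) : exists u,
    (f u + (P u)%:E < (alpha + n.+1%:R^-1)%:E)%E.
  have n0 : 0 < (n.+1%:R^-1 : R) by rewrite invr_gt0 ltr0n.
  have [r [u ur] rn] := inf_adherent n0 (conj A0 lA).
  by exists u; rewrite ur lte_fin.
have ubnd : bounded_fun u_.
  have [M MP] := coercive_sublevel_bounded (alpha + 1).
  exists M; split; first exact: num_real.
  move=> r Mr n _ /=; apply: le_trans (ltW Mr); apply: MP.
  apply: le_trans (_ : f (u_ n) + (P (u_ n))%:E <= _)%E.
    by rewrite -[leLHS]adde0 leeD// lee_fin.
  apply: le_trans (ltW (uP n)) _; rewrite lee_fin lerD2l.
  by rewrite invf_le1 ?ltr0n// ler1n.
have [phi [h [p [phi_homo hcts hconv hu Pp]]]] := compactP _ ubnd.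
(* Along the subsequence, [f] is below [alpha + n.+1%:R^-1 - P] and [P >= p - c * h]; once [h] and
   [n.+1%:R^-1] are at most [e], the bound with [(1 + c) * e] follows. *)
pose S (e : R) := [set u | (f u <= (alpha - p + (1 + c) * e)%:E)%E /\ h u <= e].
have S0 (e : R) : 0 < e -> S e !=set0.
  move=> e0.
  have /filter_ex[n [hn ne]] : \forall n \near \oo,
      h (u_ (phi n)) <= e /\ n.+1%:R^-1 < e.
    near=> n; split; near: n; last exact: near_infty_natSinv_lt (PosNum e0).
    by apply: filterS (cvgr_lt _ hu _ e0) => n /ltW.
  exists (u_ (phi n)); split => //; have := uP (phi n).
  (* A strictly increasing [phi] satisfies [n <= phi n]. *)
  have : (phi n).+1%:R^-1 <= n.+1%:R^-1 :> R.
    rewrite lef_pV2 ?posrE ?ltr0n// ler_nat ltnS.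
    elim: n {hn ne} => // n ih; apply: leq_ltn_trans ih _; exact: phi_homo.
  have := Pp (u_ (phi n)); rewrite ler_norml => /andP[Pn _].
  have := ler_wpM2l c0 hn.
  case: (f _) => [r| |] ; rewrite ?leNye// -EFinD lte_fin lee_fin.
  by move: (_^-1) (_^-1) ne => a b; lra.
have subS (e e' : R) : e <= e' -> S e `<=` S e'.
  move=> ee' u [fu hu']; split; last exact: le_trans ee'.
  by apply: le_trans fu _; rewrite lee_fin lerD2l ler_wpM2l// addr_ge0.
pose F := filter_from [set e : R | 0 < e] S.
have FF : ProperFilter F.
  apply: filter_from_proper; last by move=> e; exact: S0.
  apply: filter_from_filter; first by exists 1 => /=.
  move=> e e' /= e0 e'0; exists (Num.min e e'); first by rewrite /= lt_min e0.
  by move=> u Su; split; apply: subS Su; rewrite ge_min lexx ?orbT.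
have [M MP] := coercive_sublevel_bounded (alpha - p + (1 + c) * 1).
have FM : F [set v | `|v| <= M] by exists 1 => //= u [/MP].
have [x xP] := reflexive_space_compact reflX FF FM.
have clf (r : R) : closed [set u | (f u <= r%:E)%E].
  rewrite (_ : mkset _ = ~` [set u | (r%:E < f u)%E]).
    by apply: open_closedC; move/lower_semicontinuousP : f_lsc; exact.
  by apply/seteqP; split=> u /=; rewrite leNgt => /negP.
have Sx (e : R) : 0 < e -> S e x.
  move=> e0; apply: xP; last by exists e.
  - apply: closedI; first exact: clf.
    move/continuous_closedP : hcts => /(_ [set y | y <= e]).
    by apply; exact: closed_le.
  - move=> u v t [fu hu1] [fv hv1] t01; split; first exact: convex_sublevel.
    apply: le_trans (hconv _ _ _ t01) _; have /andP[t0 t1] := t01.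
    have s0 : 0 <= 1 - t by rewrite subr_ge0.
    by have := ler_wpM2l t0 hu1; have := ler_wpM2l s0 hv1; lra.
exists x => v; apply: le_trans (alphaP v); apply/lee_addgt0Pr => e e0.
have c1 : 0 < 1 + 2 * c by lra.
(* The bounds [f x <= alpha - p + (1 + c) * e'] and [P x <= p + c * e'] add up to
   [alpha + (1 + 2 * c) * e'], that is [alpha + e]. *)
pose e' := e / (1 + 2 * c).
have [|fx hx] := Sx e'; first by rewrite divr_gt0.
have := Pp x; rewrite ler_norml => /andP[_ Px].
have := ler_wpM2l c0 hx => chx.
apply: le_trans (leeD fx (lexx _)) _; rewrite -!EFinD lee_fin.
have : (1 + 2 * c) * e' = e by rewrite /e' mulrC divfK// gt_eqF.
by lra.
Unshelve. all: by end_near. Qed.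

End existence_of_minimizers.

(** * The L^1 norm, the largest-K-norm and the penalty *)

Section norm1.
Context d (T : measurableType d) (R : realType).
Variable mu : {measure set T -> \bar R}.
Implicit Types u v : T -> R.

(** [fine] sends an infinite norm to 0, hence the hypotheses of membership in [Lfun mu 1] below. *)
Definition norm1 u : R := fine (L1norm mu u).

Lemma norm1_ge0 u : 0 <= norm1 u.
Proof. exact/fine_ge0/Lnorm_ge0. Qed.

Lemma norm1E u : u \in Lfun mu 1 -> L1norm mu u = (norm1 u)%:E.
Proof.
rewrite inE => /andP[_]; rewrite inE/= => u1.
by rewrite /norm1 fineK// ge0_fin_numE// Lnorm_ge0.
Qed.

Lemma Lfun_measurable u : u \in Lfun mu 1 -> measurable_fun setT u.
Proof. by rewrite inE => /andP[]; rewrite inE. Qed.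

Lemma ler_norm1D u v : u \in Lfun mu 1 -> v \in Lfun mu 1 ->
  norm1 (u + v) <= norm1 u + norm1 v.
Proof.
move=> u1 v1; rewrite -lee_fin EFinD -!norm1E//; last first.
  by apply: rpredD.
exact: minkowski_EFin (Lfun_measurable u1) (Lfun_measurable v1) (lexx 1).
Qed.

Lemma norm1Z (a : R) u : u \in Lfun mu 1 ->
  norm1 (fun x => a * u x) = `|a| * norm1 u.
Proof.
move=> u1; have mu1 := Lfun_measurable u1.
rewrite /norm1 /L1norm !Lnorm1.
under eq_integral do rewrite /= normrM EFinM.
have uE : (\int[mu]_x `|u x|%:E)%E = (norm1 u)%:E.
  by rewrite -norm1E// /L1norm Lnorm1.
rewrite ge0_integralZl_EFin//.
  by rewrite uE -EFinM /= /norm1 /L1norm Lnorm1.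
exact/measurable_EFinP/measurableT_comp.
Qed.

Lemma norm1_ae u v : u \in Lfun mu 1 -> v \in Lfun mu 1 ->
  u = v %[ae mu] -> norm1 u = norm1 v.
Proof.
move=> u1 v1 uv; rewrite /norm1 /L1norm !Lnorm1; congr fine.
apply: ae_eq_integral => //.
- exact/measurable_EFinP/measurableT_comp/Lfun_measurable.
- exact/measurable_EFinP/measurableT_comp/Lfun_measurable.
- by apply: filterS uv => x /= /(_ I) -> _.
Qed.

Lemma LspaceType1_Lfun (u : LspaceType1 mu) : (u : T -> R) \in Lfun mu 1.
Proof.
rewrite inE; apply/andP; split; rewrite inE/=.
  exact: (measurable_funPT (repr (u : {mfun_ mu, T >-> measurableTypeR R}))).
exact: Lebesgue_finite.
Qed.

Section largest_norm.
Variable K : R.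
Hypothesis K_ge0 : 0 <= K.

Lemma largest_norm_ge0 u : (0 <= largest_norm mu K u)%E.
Proof.
(* The empty set is admissible because [K] is nonnegative. *)
apply: ereal_sup_ubound; exists set0; last by rewrite integral_set0.
by rewrite /= measure0 lee_fin.
Qed.

Lemma largest_norm_le_L1norm u : measurable_fun setT u ->
  (largest_norm mu K u <= L1norm mu u)%E.
Proof.
move=> mu1; apply: ge_ereal_sup => _ [A [mA _] <-].
rewrite /L1norm Lnorm1; apply: ge0_subset_integral => //.
exact/measurable_EFinP/measurableT_comp.
Qed.

(** After the triangle inequality on an admissible [A], the integral of [v] is enlarged to the whole
    space. In this form the lemma makes the largest-K-norm 1-Lipschitz for the L^1 norm. *)
Lemma largest_normD u v : measurable_fun setT u -> measurable_fun setT v ->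
  (largest_norm mu K (u + v)%R <= largest_norm mu K u + L1norm mu v)%E.
Proof.
move=> mu1 mv1; apply: ge_ereal_sup => _ [A [mA muA] <-].
have mn (w : T -> R) : measurable_fun setT w ->
    measurable_fun setT (fun x => `|w x|%:E : \bar R).
  by move=> mw; exact/measurable_EFinP/measurableT_comp.
have mnA (w : T -> R) : measurable_fun setT w ->
    measurable_fun A (fun x => `|w x|%:E : \bar R).
  by move=> /mn mw; apply: measurable_funS mw.
apply: (@le_trans _ _ (\int[mu]_(x in A) (`|u x|%:E + `|v x|%:E))%E).
  apply: ge0_le_integral => //.
  - by apply: mnA; apply: measurable_funD.
  - by apply: emeasurable_funD; exact: mnA.
  - by move=> x _; rewrite -EFinD lee_fin ler_normD.
rewrite ge0_integralD//; [|exact: mnA|exact: mnA].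
apply: leeD.
  by apply: ereal_sup_ubound; exists A.
by rewrite /L1norm Lnorm1; apply: ge0_subset_integral => //; exact: mn.
Qed.

Definition penalty u : R := norm1 u - fine (largest_norm mu K u).

Lemma largest_norm_fin_num u : u \in Lfun mu 1 ->
  largest_norm mu K u \is a fin_num.
Proof.
move=> u1; rewrite ge0_fin_numE ?largest_norm_ge0//.
apply: le_lt_trans (largest_norm_le_L1norm (Lfun_measurable u1)) _.
by rewrite norm1E// ltry.
Qed.

Lemma penaltyE u : u \in Lfun mu 1 ->
  (L1norm mu u - largest_norm mu K u = (penalty u)%:E)%E.
Proof.
by move=> u1; rewrite norm1E// /penalty EFinB (fineK (largest_norm_fin_num u1)).
Qed.

Lemma penalty_ge0 u : u \in Lfun mu 1 -> 0 <= penalty u.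
Proof.
move=> u1; rewrite subr_ge0 -lee_fin fineK ?largest_norm_fin_num// -norm1E//.
exact/largest_norm_le_L1norm/Lfun_measurable.
Qed.

(** Each of the two terms of the penalty is 1-Lipschitz for the L^1 norm. *)
Lemma ler_dist_penalty u v : u \in Lfun mu 1 -> v \in Lfun mu 1 ->
  `|penalty u - penalty v| <= 2 * norm1 (u - v).
Proof.
have largestB w z : w \in Lfun mu 1 -> z \in Lfun mu 1 ->
    fine (largest_norm mu K w) <= fine (largest_norm mu K z) + norm1 (w - z).
  move=> w1 z1; have wz1 : w - z \in Lfun mu 1 by apply: rpredB.
  rewrite -lee_fin EFinD -norm1E// !(fineK (largest_norm_fin_num _))//.
  have := largest_normD (Lfun_measurable z1) (Lfun_measurable wz1).
  by rewrite addrC subrK.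
move=> u1 v1.
have uv1 : u - v \in Lfun mu 1 by apply: rpredB.
have vu1 : v - u \in Lfun mu 1 by apply: rpredB.
have vuE : norm1 (v - u) = norm1 (u - v).
  transitivity (norm1 (fun x => -1 * (u - v) x)).
    congr norm1; apply/funext => x.
    by rewrite mulN1r -[RHS]/((- (u - v)) x) opprB.
  by rewrite norm1Z// normrN1 mul1r.
have := largestB _ _ u1 v1; have := largestB _ _ v1 u1.
have := ler_norm1D uv1 v1; have := ler_norm1D vu1 u1.
rewrite !subrK vuE /penalty ler_norml => *; apply/andP; split; lra.
Qed.

End largest_norm.
End norm1.

(** * Distance in L^1 from embedded points to a fixed function *)

Section compact_embedding_dist1.
Context d (T : measurableType d) (R : realType).
Variables (mu : {measure set T -> \bar R}) (X : normedModType R).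
Variable iota : X -> LspaceType1 mu.
Hypothesis iotaP : compact_embedding iota.

(** Linearity at [1 *: 0 + 0] gives [iota 0 = iota 0 + iota 0] almost everywhere. *)
Lemma compact_embedding0 : (iota 0 : T -> R) = cst 0 %[ae mu].
Proof.
have [/(_ 1 0 0) + _ _ _] := iotaP; rewrite scale1r addr0.
by apply: filterS => x /(_ I) h _ /=; move: h; lra.
Qed.

Lemma compact_embedding_comb (a b : R) (u v : X) :
  (iota (a *: u + b *: v) : T -> R) = (fun x => a * iota u x + b * iota v x)
    %[ae mu].
Proof.
have [lin _ _ _] := iotaP.
have l1 := lin a u (b *: v); have := lin b v 0; rewrite addr0 => l2.
have l0 := compact_embedding0.
by apply: filterS3 l1 l2 l0 => x /(_ I) -> /(_ I) -> /(_ I) -> _; rewrite addr0.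
Qed.

Lemma Lfun_scalel (a : R) (u : T -> R) : u \in Lfun mu 1 ->
  (fun x => a * u x) \in Lfun mu 1.
Proof.
move=> u1; rewrite (_ : (fun x => _) = (a \o* u)); first exact: Lfun_scale.
by apply/funext => x /=; rewrite mulrC.
Qed.

Variable g : LspaceType1 mu.

(** Plays the role of [h] in [exists_global_solution]. *)
Definition dist1 (u : X) : R := norm1 mu (fun x => iota u x - g x).

Local Notation g_ := (g : T -> R).
Local Notation iota_ u := (iota u : T -> R).

Let g1 : (g : T -> R) \in Lfun mu 1 := LspaceType1_Lfun g.
Let i1 u : (iota u : T -> R) \in Lfun mu 1 := LspaceType1_Lfun (iota u).

(** The weights sum to 1, so [g] can be distributed over the two terms, almost everywhere; the
    triangle inequality does the rest. *)
Lemma dist1_convex u v (t : R) : 0 <= t <= 1 ->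
  dist1 (t *: u + (1 - t) *: v) <= t * dist1 u + (1 - t) * dist1 v.
Proof.
move=> /andP[t0 t1].
have ug : iota_ u - g_ \in Lfun mu 1 by apply: rpredB.
have vg : iota_ v - g_ \in Lfun mu 1 by apply: rpredB.
have tug : (fun x => t * (iota_ u - g_) x) \in Lfun mu 1.
  exact: Lfun_scalel.
have tvg : (fun x => (1 - t) * (iota_ v - g_) x) \in Lfun mu 1.
  exact: Lfun_scalel.
have <- : norm1 mu (fun x => t * (iota_ u - g_) x) = t * dist1 u.
  by rewrite norm1Z// ger0_norm.
have <- : norm1 mu (fun x => (1 - t) * (iota_ v - g_) x) = (1 - t) * dist1 v.
  by rewrite norm1Z// ger0_norm// subr_ge0.
apply: le_trans (ler_norm1D tug tvg).
rewrite le_eqVlt; apply/orP; left; apply/eqP; apply: norm1_ae.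
- exact: (@rpredB _ (Lfun mu 1)).
- exact: (@rpredD _ (Lfun mu 1)).
- apply: filterS (compact_embedding_comb t (1 - t) u v) => x /(_ I) -> _.
  rewrite -[RHS]/(t * (iota u x - g x) + (1 - t) * (iota v x - g x)); ring.
Qed.

Lemma ler_dist_dist1 : exists2 C : R, 0 < C &
  forall u v, `|dist1 u - dist1 v| <= C * `|u - v|.
Proof.
have [_ _ [C Cbnd] _] := iotaP.
(* The embedding constant [C] may be nonpositive, while the continuity proof divides by the constant
   chosen here. *)
exists (`|C| + 1); first by rewrite ltr_wpDl.
have lip u v : dist1 u - dist1 v <= (`|C| + 1) * `|u - v|.
  rewrite lerBlDr.
  have uv1 : iota_ u - iota_ v \in Lfun mu 1 by apply: rpredB.
  have vg : iota_ v - g_ \in Lfun mu 1 by apply: rpredB.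
  have -> : dist1 u = norm1 mu (iota_ u - iota_ v + (iota_ v - g_)).
    by rewrite addrA subrK.
  apply: le_trans (ler_norm1D uv1 vg) _; rewrite lerD2r.
  have -> : norm1 mu (iota_ u - iota_ v) = norm1 mu (iota (u - v)).
    apply: norm1_ae => //.
    have := compact_embedding_comb 1 (-1) u v; rewrite scale1r scaleN1r.
    by apply: filterS => x /(_ I) -> _; rewrite mul1r mulN1r.
  rewrite -lee_fin -norm1E//; apply: le_trans (Cbnd _) _; rewrite lee_fin.
  by rewrite ler_wpM2r//; apply: le_trans (ler_norm C) _; rewrite lerDl.
move=> u v; rewrite ler_norml; apply/andP; split; last exact: lip.
by rewrite lerNl opprB distrC; exact: lip.
Qed.

Lemma dist1_continuous : continuous dist1.
Proof.
have [C C0 lip] := ler_dist_dist1.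
move=> u; apply/cvgrPdist_le => e e0; near=> v.
apply: le_trans (lip u v) _; rewrite -ler_pdivlMl//.
near: v; apply: cvgr_dist_le; first exact: cvg_id.
by rewrite mulr_gt0// invr_gt0.
Unshelve. all: by end_near. Qed.

End compact_embedding_dist1.

Local Open Scope ereal_scope.

Theorem lemma5p3 (R : realType) (d : measure_display) (T : measurableType d)
    (mu : {sigma_finite_measure set T -> \bar R}) (K : R)
    (K_gt0 : (0 < K)%R) (K_lt : K%:E < mu [set: T])
    (X : completeNormedModType R) (X_refl : reflexive_space X)
    (iota : X -> LspaceType1 mu) (iota_compact : compact_embedding iota)
    (f : X -> \bar R)
    (f_proper : proper_functional f)
    (f_lsc : lower_semicontinuous f)
    (f_convex : convex_functional f)
    (f_bounded : bounded_below f)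
    (f_coercive : coercive f)
    (u0_exists : exists u0 : X, f u0 < +oo /\ L0norm mu (iota u0) <= K%:E)
    (rho : R) (rho_gt0 : (0 < rho)%R) :
  exists ubar : X,
    global_solution
      (fun u => f u +
        rho%:E * (L1norm mu (iota u) - largest_norm mu K (iota u))) ubar.
Proof.
have K_ge0 := ltW K_gt0; have rho_ge0 := ltW rho_gt0.
have iota1 u := LspaceType1_Lfun (iota u).
(* The penalty is finite on L^1, so it can be rewritten as a real-valued function. *)
under [X in exists ubar, global_solution X ubar]eq_fun => u.
  rewrite (penaltyE K_ge0 (iota1 u)) -EFinM; over.
(* The constant is [rho] times the Lipschitz constant 2 of [penalty]. *)
apply: (@exists_global_solution _ _ _ f_convex f_coercive _ (rho * 2)%R) => //.
- by rewrite mulr_ge0.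
- by move=> u; rewrite mulr_ge0// (penalty_ge0 K_ge0).
move=> u_ /(let: And4 _ _ _ c := iota_compact in c u_)[phi [g [phiP cvg_g]]].
exists phi, (dist1 iota g), (rho * penalty mu K g)%R; split=> //.
- exact: dist1_continuous.
- exact: dist1_convex.
- exact: fine_cvg cvg_g.
- move=> u; rewrite -mulrBr normrM ger0_norm// -mulrA ler_wpM2l//.
  exact: (ler_dist_penalty K_ge0 (iota1 u) (LspaceType1_Lfun g)).
Qed.
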